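(* Suppose $P$ is a probability distribution on $\mathbb{R}^d$ with positive volume dimension $d_{\mathrm{vol}}=d_{\mathrm{vol}}(P)>0$ (relative to the fixed set $\mathbb{X}\subset\mathbb{R}^d$) satisfying $$\sup_{x\in\mathbb{X}}\liminf_{r\to0}\frac{P(\mathbb{B}_{\mathbb{R}^d}(x,r))}{r^{d_{\mathrm{vol}}}}>0.$$ Let $K:\mathbb{R}^d\to\mathbb{R}$ be a kernel function with $\|K\|_\infty<\infty$, $\int_0^\infty t^{d_{\mathrm{vol}}-1}\sup_{\|x\|\ge t}|K(x)|\,dt<\infty$, and $\lim_{t\to0}\inf_{\|x\|\le t}K(x)>0$. Suppose $l_n\to0$ with $n l_n^{d_{\mathrm{vol}}}\to\infty$. Then, with probability $1-\delta$, the following holds for all large $n$: $$\sup_{h\ge l_n,\,x\in\mathbb{X}}|\hat p_h(x)-p_h(x)|\ge C_{P,K,\delta}\sqrt{\frac{1}{n l_n^{2d-d_{\mathrm{vol}}}}},$$ where $C_{P,K,\delta}$ is a (positive) constant depending only on $P$, $K$ and $\delta$.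
   Context: A subset $\mathbb{X}\subset\mathbb{R}^d$ is fixed, $(l_n)$ is a sequence of positive numbers, and $\delta\in(0,1)$. $\|\cdot\|$ is the Euclidean norm, $\|K\|_\infty$ is the sup norm, and $\mathbb{B}_{\mathbb{R}^d}(x,r)=\{y\in\mathbb{R}^d:\|y-x\|<r\}$. The volume dimension of $P$ is $$d_{\mathrm{vol}}(P)=\sup\left\{\nu\ge0:\ \limsup_{r\to0}\sup_{x\in\mathbb{X}}\frac{P(\mathbb{B}_{\mathbb{R}^d}(x,r))}{r^\nu}<\infty\right\}.$$ Kernel density estimator based on $X_1,\dots,X_n$ i.i.d. from $P$: $\hat p_h(x)=\frac{1}{nh^d}\sum_{i=1}^nK\left(\frac{x-X_i}{h}\right)$, and $p_h(x)=\mathbb{E}[\hat p_h(x)]$. *)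

(* Defs.v *)
From HB Require Import structures.
From mathcomp Require Import all_boot all_order all_algebra.
From mathcomp Require Import all_classical all_reals all_analysis.

Set Implicit Arguments.
Unset Strict Implicit.
Unset Printing Implicit Defensive.

Import Order.TTheory GRing.Theory Num.Theory.
Import numFieldNormedType.Exports.

Local Open Scope classical_set_scope.
Local Open Scope ring_scope.

(* R^d with its Borel sigma-algebra: the library equips 'rV[R]_d with a
   topology but not with a measurable structure.  The topology is the usual
   one (it is induced there by the max norm). *)
Definition Rvec (R : realType) (d : nat) : Type := 'rV[R]_d.

HB.instance Definition _ (R : realType) (d : nat) :=
  GRing.Lmodule.copy (Rvec R d) 'rV[R]_d.
HB.instance Definition _ (R : realType) (d : nat) :=
  Measurable.copy (Rvec R d) (g_sigma_algebraType (@open 'rV[R]_d)).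

(* Not the library norm `|x|, which on 'rV[R]_d is the max norm. *)
Definition enorm (R : realType) (d : nat) (x : Rvec R d) : R :=
  Num.sqrt (\sum_(i < d) (x : 'rV[R]_d) ord0 i ^+ 2).

Definition eball (R : realType) (d : nat) (x : Rvec R d) (r : R) :
    set (Rvec R d) :=
  [set y | enorm (y - x) < r].

(* Filter 0^'+ : the radius r tends to 0 through positive values. *)
Definition vol_dim (R : realType) (d : nat) (X : set (Rvec R d))
    (P : probability (Rvec R d) R) : \bar R :=
  ereal_sup [set nu%:E | nu in [set nu : R | 0 <= nu /\
    (limf_esup (fun r : R =>
       ereal_sup [set P (eball x r) / (r `^ nu)%:E | x in X]) 0^'+ < +oo)%E]].

(* The sample is xi 0, ..., xi n.-1. *)
Definition kde (R : realType) (d : nat) (K : Rvec R d -> R) (T : Type)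
    (xi : nat -> T -> Rvec R d) (n : nat) (h : R) (x : Rvec R d) (w : T) : R :=
  (n%:R * h ^+ d)^-1 * \sum_(i < n) K (h^-1 *: (x - xi i w)).

Definition mean_kde (R : realType) (d : nat) (K : Rvec R d -> R)
    (dT : measure_display) (T : measurableType dT) (Q : probability T R)
    (xi : nat -> T -> Rvec R d) (n : nat) (h : R) (x : Rvec R d) : R :=
  fine ('E_Q[kde K xi n h x])%E.

Definition mutually_independent (R : realType) (dT dS : measure_display)
    (T : measurableType dT) (S : measurableType dS) (Q : probability T R)
    (xi : nat -> {RV Q >-> S}) : Prop :=
  forall (s : seq nat) (A : nat -> set S),
    uniq s -> (forall i, measurable (A i)) ->
    Q (\big[setI/setT]_(i <- s) (xi i @^-1` A i)) =
    (\prod_(i <- s) Q (xi i @^-1` A i))%E.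

Definition iid_from (R : realType) (dT dS : measure_display)
    (T : measurableType dT) (S : measurableType dS) (P : probability S R)
    (Q : probability T R) (xi : nat -> {RV Q >-> S}) : Prop :=
  mutually_independent xi /\
  forall (i : nat) (A : set S), measurable A -> distribution Q (xi i) A = P A.

(* An event given by a supremum over uncountably many h and x need not be
   measurable, so "with probability at least p" is read as inner probability;
   on a measurable E this is p%:E <= Q E. *)
Definition with_prob_ge (R : realType) (dT : measure_display)
    (T : measurableType dT) (Q : probability T R) (p : R) (E : set T) : Prop :=
  exists A : set T, [/\ measurable A, A `<=` E & (p%:E <= Q A)%E].

(* Main.v *)
(** The supremum is bounded below by its value at h = l_n and one point x with
P(B(x,r)) >= c r^dvol for small r.  There the sum S of the terms
Y_i = K((x - X_i)/h) must avoid an interval of half-width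
W = eps sqrt(n h^dvol) around n h^d p_h(x); the position of the centre is
irrelevant, so no moment of Y_i is needed, only anti-concentration.
Since P(Y_i >= kappa) >= c' h^dvol while P(Y_i <= kappa/2) >= 1/2 (the tail
condition on K and P(B(x,r)) -> 0), the characteristic function satisfies
|phi(t)|^2 <= 1 - c'' t^2 h^dvol for small t.  A van der Corput type inequality
bounds P(|S - a| <= W) by (4/J^2) sum_(j,k < J) |phi((j-k)/(JW))|^n, which is
at most 8/J once eps is small compared with 1/J^2.  To keep the Fourier part
finite, Y_i is first rounded to a finite grid of mesh at most W/(2n). *)

Require Import Defs.
From HB Require Import structures.
From mathcomp Require Import all_boot all_order all_algebra.
From mathcomp Require Import all_classical all_reals all_analysis.
From mathcomp Require Import complex ring lra.

Set Implicit Arguments.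
Unset Strict Implicit.
Unset Printing Implicit Defensive.

Import Order.TTheory GRing.Theory Num.Theory.
Import numFieldNormedType.Exports.

Local Open Scope classical_set_scope.
Local Open Scope ring_scope.

(** * Quadratic bounds on the cosine *)

Section Trigo.
Context {R : realType}.
Implicit Types x y t b : R.

Lemma sin_MVT y : 0 < y -> exists2 xi, 0 < xi < y & sin y = y * cos xi.
Proof.
move=> y0.
have sin_drv x : x \in `]0, y[%R -> is_derive x 1 (sin : R -> R) (cos x).
  by move=> _; exact: is_derive_sin.
have sin_cont : {within `[0, y], continuous (sin : R -> R)}.
  by apply: continuous_subspaceT => x; exact: continuous_sin.
have [xi] := MVT y0 sin_drv sin_cont.
rewrite in_itv /= => xiy; rewrite sin0 !subr0 => ->.
by exists xi => //; rewrite mulrC.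
Qed.

Lemma one_sub_cos x : 1 - cos x = 2 * sin (x / 2) ^+ 2.
Proof.
have {1}-> : x = (x / 2) *+ 2 by rewrite -mulr_natr divfK.
rewrite cos_mulr2n sin2cos2; lra.
Qed.

Lemma sqr_sin_le y : sin y ^+ 2 <= y ^+ 2.
Proof.
wlog y0 : y / 0 < y => [H|].
  case: (ltgtP y 0) => [yN|/H//|->]; last by rewrite sin0 lexx.
  by have := H (- y); rewrite sinN !sqrrN oppr_gt0; exact.
have [z _ ->] := sin_MVT y0; rewrite exprMn ler_piMr ?sqr_ge0//.
Qed.

Lemma cos_ge_quadratic x : 1 - x ^+ 2 / 2 <= cos x.
Proof.
have := one_sub_cos x; have := sqr_sin_le (x / 2); rewrite expr_div_n; lra.
Qed.

(** By the mean value theorem sin(x/2) = (x/2) cos z with 0 < z < x/2 <= 1/2, so cos z >= 7/8. Hence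
    cos^2 z >= 1/2, and 1 - cos x = 2 sin^2(x/2) >= x^2/4. *)
Lemma cos_le_quadratic x : 0 <= x <= 1 -> cos x <= 1 - x ^+ 2 / 4.
Proof.
rewrite le_eqVlt => /andP[/orP[/eqP<- _|x0 x1]].
  by rewrite cos0 expr0n mul0r subr0.
have [|z /andP[z0 zx] sE] := @sin_MVT (x / 2); first by rewrite divr_gt0.
have := one_sub_cos x; rewrite {}sE => xE.
have c78 : 7 / 8 <= cos z.
  by apply: le_trans (cos_ge_quadratic z); nra.
have c2 : 0 <= cos z ^+ 2 - 1 / 2 by nra.
have := mulr_ge0 (sqr_ge0 x) c2; rewrite exprMn expr_div_n in xE *; lra.
Qed.

End Trigo.

(** * Characteristic functions of finitely supported weights *)

Section Characteristic.
Context {R : realType}.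
Implicit Types x y t b : R.
Import ComplexField.
Local Open Scope complex_scope.

(** This is e^{ix}. *)
Let cis x : R[i] := cos x +i* sin x.

Let cisD x y : cis (x + y) = cis x * cis y.
Proof. by rewrite /cis cosD sinD; congr (_ +i* _); rewrite addrC. Qed.

Let cis_sum (J : finType) (F : J -> R) :
  cis (\sum_j F j) = \prod_j cis (F j).
Proof. by apply: (big_morph cis cisD); rewrite /cis cos0 sin0. Qed.

Let sum_complex (J : finType) (F G : J -> R) :
  \sum_j (F j +i* G j) = (\sum_j F j) +i* (\sum_j G j).
Proof. by apply: (big_ind3 (fun z a b => z = a +i* b)) => // _ a b _ c e -> ->. Qed.

(** The squared modulus, valued in [R] so that it enters real inequalities directly. *)
Let sqrn (z : R[i]) : R := complex.Re z ^+ 2 + complex.Im z ^+ 2.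

Let sqrnM z w : sqrn (z * w) = sqrn z * sqrn w.
Proof. by case: z w => a b [c e]; rewrite /sqrn /=; ring. Qed.

Let sqrnX z n : sqrn (z ^+ n) = sqrn z ^+ n.
Proof.
elim: n => [|n IHn]; last by rewrite !exprS sqrnM IHn.
by rewrite !expr0 /sqrn /= expr1n expr0n addr0.
Qed.

(* The mean on the left is Re (phi(t)^n e^{-ib}), with phi the characteristic
   function of the weights q at the points v. *)
Lemma sqr_mean_cos_sum_le (I : finType) (q v : I -> R) n t b :
  (\sum_(z : {ffun 'I_n -> I})
     (\prod_k q (z k)) * cos (t * (\sum_k v (z k)) - b)) ^+ 2 <=
  ((\sum_i q i * cos (t * v i)) ^+ 2 +
   (\sum_i q i * sin (t * v i)) ^+ 2) ^+ n.
Proof.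
pose phi := \sum_i (q i * cos (t * v i)) +i* (q i * sin (t * v i)).
have -> : (\sum_i q i * cos (t * v i)) ^+ 2 +
          (\sum_i q i * sin (t * v i)) ^+ 2 = sqrn phi.
  by rewrite /phi sum_complex.
(* Distributing the n-th power over the sum gives one term per sample [z], with phase t times the
   sum of the points, minus b. *)
have phiX : phi ^+ n * cis (- b) =
    \sum_(z : {ffun 'I_n -> I})
      ((\prod_k q (z k)) * cos (t * (\sum_k v (z k)) - b) +i*
       ((\prod_k q (z k)) * sin (t * (\sum_k v (z k)) - b))).
  rewrite -[n in LHS]card_ord -prodr_const bigA_distr_bigA mulr_suml.
  apply: eq_bigr => z _.
  have -> : \prod_i (q (z i) * cos (t * v (z i)) +i* (q (z i) * sin (t * v (z i))))
      = (\prod_k q (z k))%:C * cis (t * (\sum_k v (z k))).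
    rewrite mulr_sumr cis_sum rmorph_prod -big_split/=; apply: eq_bigr => k _.
    by rewrite /cis; congr (_ +i* _); ring.
  by rewrite -mulrA -cisD /cis; congr (_ +i* _); ring.
have cisn : sqrn (cis (- b)) = 1 by rewrite /sqrn/= cos2Dsin2.
have -> : sqrn phi ^+ n = sqrn (phi ^+ n * cis (- b)).
  by rewrite sqrnM cisn mulr1 sqrnX.
(* The real part is the cosine mean; the squared imaginary part is dropped. *)
by rewrite phiX sum_complex /sqrn/= lerDl sqr_ge0.
Qed.

End Characteristic.

(** * Anti-concentration of sums of finitely valued independent variables *)

Section SmallBall.
Context {R : realType} {I : finType} (q v : I -> R).
Context (q_ge0 : forall i, 0 <= q i) (q_sum1 : \sum_i q i = 1).

(** Symmetrisation: 1 - |phi(t)|^2 is the mean of 1 - cos(t(V - V')) for two independent copies. All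
    terms are nonnegative, so only the pairs in [H] x [L] are kept; there t(V - V') lies in [0, 1]
    and [cos_le_quadratic] applies. *)
Lemma sqr_charfun_le (H L : pred I) (g B t : R) : 0 <= g -> 0 <= t ->
  t * B <= 1 ->
  (forall i j, H i -> L j -> g <= v i - v j <= B) ->
  (\sum_i q i * cos (t * v i)) ^+ 2 + (\sum_i q i * sin (t * v i)) ^+ 2 <=
  1 - (\sum_(i | H i) q i) * (\sum_(i | L i) q i) * (t * g) ^+ 2 / 4.
Proof.
move=> g0 t0 tB HL.
have -> : (\sum_i q i * cos (t * v i)) ^+ 2 +
          (\sum_i q i * sin (t * v i)) ^+ 2 =
  1 - \sum_i \sum_j q i * q j * (1 - cos (t * (v i - v j))).
  (* The constant 1 becomes the square of the total weight, so that all terms are double sums over i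
     and j. *)
  rewrite -[X in _ = X - _](mulr1 1) -[X in _ = X * X - _]q_sum1.
  rewrite !expr2 !big_distrlr/=.
  rewrite -big_split -sumrB; apply: eq_bigr => i _ /=.
  rewrite -big_split -sumrB; apply: eq_bigr => j _ /=.
  by rewrite (mulrBr t) cosB; ring.
rewrite lerD2l lerN2 [X in X <= _](_ : _ =
  \sum_(i | H i) \sum_(j | L j) q i * q j * ((t * g) ^+ 2 / 4)); last first.
  rewrite -mulrA big_distrlr/= mulr_suml; apply: eq_bigr => i _.
  by rewrite mulr_suml.
have qcos_ge0 i j : 0 <= q i * q j * (1 - cos (t * (v i - v j))).
  by rewrite mulr_ge0 ?mulr_ge0 ?subr_ge0 ?cos_le1.
rewrite [leRHS](bigID H)/= ler_wpDr//; first by rewrite !sumr_ge0// => *; exact: sumr_ge0.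
apply: ler_sum => i Hi; rewrite [leRHS](bigID L)/= ler_wpDr ?sumr_ge0//.
apply: ler_sum => j Lj; rewrite ler_wpM2l ?mulr_ge0//.
have /andP[gv vB] := HL _ _ Hi Lj.
have v0 := le_trans g0 gv.
have tv : 0 <= t * (v i - v j) <= 1.
  by rewrite mulr_ge0//= (le_trans _ tB)// ler_wpM2l.
have := cos_le_quadratic tv.
have : (t * g) ^+ 2 <= (t * (v i - v j)) ^+ 2.
  by rewrite ler_sqr ?nnegrE ?mulr_ge0// ler_wpM2l.
lra.
Qed.

Lemma sum_prod_eq1 n : \sum_(z : {ffun 'I_n -> I}) \prod_k q (z k) = 1.
Proof.
rewrite -(bigA_distr_bigA (fun _ => q)) big1// => k _; exact: q_sum1.
Qed.

(* Van der Corput: for s = 1/(JW) the kernel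
   |sum_(j < J) e^{ijs(S - a)}|^2 is at least J^2/4 when |S - a| <= W, and its
   mean is controlled by the characteristic function at the points (j - k)s. *)
Lemma small_ball (H L : pred I) (g B W y a p r : R) (J n : nat) :
  0 <= g -> 0 < W -> B <= W -> (0 < J)%N -> 0 <= y ->
  0 <= p -> p <= \sum_(i | H i) q i -> 0 <= r -> r <= \sum_(i | L i) q i ->
  (forall i j, H i -> L j -> g <= v i - v j <= B) ->
  (1 - p * r * (g / (J%:R * W)) ^+ 2 / 4) ^+ n <= y ^+ 2 ->
  \sum_(z : {ffun 'I_n -> I} | `|\sum_k v (z k) - a| <= W) \prod_k q (z k)
    <= 4 / J%:R + 4 * y.
Proof.
move=> g0 W0 BW J0 y0 p0 pH r0 rL HL ny.
have J0' : 0 < J%:R :> R by rewrite ltr0n.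
pose s := (J%:R * W)^-1.
have s0 : 0 < s by rewrite invr_gt0 mulr_gt0.
pose pz (z : {ffun 'I_n -> I}) := \prod_k q (z k).
pose S (z : {ffun 'I_n -> I}) := \sum_k v (z k).
have pz0 z : 0 <= pz z by exact: prodr_ge0.
have Ecos_pos t : s <= t <= W^-1 -> \sum_z pz z * cos (t * S z - t * a) <= y.
  move=> /andP[st tW]; have t0 : 0 <= t by exact: le_trans (ltW s0) st.
  rewrite ler_normlW// -ler_sqr ?nnegrE// real_normK ?num_real//.
  apply: le_trans (sqr_mean_cos_sum_le _ _ _ _ _) _; apply: le_trans ny.
  have le1 := sqr_charfun_le g0 t0 (le_trans (ler_wpM2l t0 BW) _) HL.
  (* [t <= W^-1] and [B <= W] give tB <= 1, and s <= t makes the deficit at t at least the one at s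
     = 1/(JW). *)
  have {}le1 : (\sum_i q i * cos (t * v i)) ^+ 2 +
      (\sum_i q i * sin (t * v i)) ^+ 2 <=
      1 - p * r * (g / (J%:R * W)) ^+ 2 / 4.
    apply: le_trans (le1 _) _; first by rewrite -ler_pdivlMr// div1r.
    rewrite lerD2l lerN2 ler_pM2r ?invr_gt0//.
    apply: ler_pM; [exact: mulr_ge0|exact: sqr_ge0|exact: ler_pM|].
    have sg : g / (J%:R * W) <= t * g by rewrite mulrC ler_wpM2r.
    rewrite ler_sqr ?nnegrE//; first by rewrite mulr_ge0// ltW.
    by rewrite mulr_ge0.
  by apply: lerXn2r => //; rewrite nnegrE ?(le_trans _ le1)// addr_ge0// sqr_ge0.
(* Evenness of the cosine reduces negative t to positive t. *)
have Ecos t : s <= `|t| <= W^-1 -> \sum_z pz z * cos (t * S z - t * a) <= y.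
  case: (leP 0 t) => [t0|t0]; first by rewrite ger0_norm//; exact: Ecos_pos.
  rewrite ltr0_norm// => /Ecos_pos; under eq_bigr do rewrite -cosN.
  by under eq_bigr do rewrite !mulNr opprB addrC opprK.
pose D x := \sum_(j < J) \sum_(k < J) cos ((j%:R - k%:R) * s * x).
have D_ge x : 0 <= D x /\ (`|x| <= W -> J%:R ^+ 2 / 4 <= D x).
  have -> : D x = (\sum_(j < J) cos (j%:R * s * x)) ^+ 2 +
                  (\sum_(j < J) sin (j%:R * s * x)) ^+ 2.
    rewrite !expr2 !big_distrlr -big_split/=; apply: eq_bigr => j _.
    rewrite -big_split; apply: eq_bigr => k _ /=.
    by rewrite !mulrBl cosB.
  split => [|xW]; first by rewrite addr_ge0// sqr_ge0.
  rewrite ler_wpDr ?sqr_ge0//.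
  have -> : J%:R ^+ 2 / 4 = (J%:R / 2) ^+ 2 :> R by field.
  (* When |x| <= W, |jsx| <= JsW = 1, so the cosine is at least 1 - 1/2. *)
  have cos_half (j : 'I_J) : 2^-1 <= cos (j%:R * s * x).
    apply: le_trans (cos_ge_quadratic _).
    suff : (j%:R * s * x) ^+ 2 <= 1 by lra.
    rewrite -real_normK ?num_real// expr_le1// !normrM ger0_norm// gtr0_norm//.
    have sJW : J%:R * s * W = 1 by rewrite /s; field; rewrite !gt_eqF.
    rewrite -[leRHS]sJW ler_pM ?mulr_ge0// ?(ltW s0)//.
    by rewrite ler_pM2r// ler_nat ltnW.
  have sum_half : J%:R / 2 <= \sum_(j < J) cos (j%:R * s * x).
    rewrite mulr_natl -[X in _ *+ X]card_ord -sumr_const.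
    by apply: ler_sum => j _; exact: cos_half.
  have J2 : 0 <= J%:R / 2 :> R by rewrite divr_ge0.
  by rewrite ler_sqr ?nnegrE ?(le_trans J2).
rewrite big_mkcond/=.
(* Markov step: 4/J^2 times [D] is nonnegative everywhere and at least 1 on the event. *)
apply: (@le_trans _ _ (\sum_z pz z * (4 / J%:R ^+ 2 * D (S z - a)))).
  apply: ler_sum => z _; have [D0 DW] := D_ge (S z - a).
  case: ifPn => [/DW SW|_].
    suff : 1 <= 4 / J%:R ^+ 2 * D (S z - a).
      by move=> D1; apply: ler_peMr D1; exact: pz0.
    rewrite mulrC mulrA ler_pdivlMr ?exprn_gt0// mul1r.
    by move: SW; rewrite ler_pdivrMr.
  by rewrite !mulr_ge0// divr_ge0// exprn_ge0// ltW.
have -> : \sum_z pz z * (4 / J%:R ^+ 2 * D (S z - a)) =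
  4 / J%:R ^+ 2 * \sum_(j < J) \sum_(k < J) \sum_z pz z *
     cos ((j%:R - k%:R) * s * S z - (j%:R - k%:R) * s * a).
  under [in RHS]eq_bigr do rewrite exchange_big/=.
  rewrite exchange_big/= mulr_sumr; apply: eq_bigr => z _.
  rewrite mulrCA /D; congr (_ * _); rewrite mulr_sumr; apply: eq_bigr => j _.
  by rewrite mulr_sumr; apply: eq_bigr => k _; rewrite mulrBr.
(* A diagonal term has mean 1. Off the diagonal, 1 <= |j - k| <= J places |j - k|s between s and Js
   = 1/W, the range of [Ecos]. *)
have jk (j k : 'I_J) : \sum_z pz z * cos ((j%:R - k%:R) * s * S z - (j%:R - k%:R) * s * a)
   <= (j == k :> nat)%:R + y.
  have [->|/eqP jk] := eqVneq (j : nat) k.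
    rewrite subrr !mul0r; under eq_bigr do rewrite !mul0r subrr cos0 mulr1.
    by rewrite sum_prod_eq1 lerDl.
  rewrite add0r; apply: Ecos; rewrite normrM (gtr0_norm s0).
  have dist1 : 1 <= `|j%:R - k%:R : R|.
    have [kj|kj|/esym/jk//] := ltngtP k j.
      by rewrite -natrB ?(ltnW kj)// normr_nat ler1n subn_gt0.
    by rewrite distrC -natrB ?(ltnW kj)// normr_nat ler1n subn_gt0.
  have distJ : `|j%:R - k%:R : R| <= J%:R.
    have jJ : j%:R <= J%:R :> R by rewrite ler_nat ltnW.
    have kJ : k%:R <= J%:R :> R by rewrite ler_nat ltnW.
    by rewrite ler_norml; have := ler0n R j; have := ler0n R k; lra.
  rewrite ler_peMl ?(ltW s0)//= (le_trans (ler_wpM2r (ltW s0) distJ))//.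
  by rewrite /s invfM mulrA divff ?mul1r// gt_eqF.
apply: (@le_trans _ _ (4 / J%:R ^+ 2 *
    \sum_(j < J) \sum_(k < J) ((j == k :> nat)%:R + y))).
  by rewrite ler_wpM2l ?divr_ge0 ?exprn_ge0//; do 2 apply: ler_sum => ? _.
have -> : \sum_(j < J) \sum_(k < J) ((j == k :> nat)%:R + y) =
    J%:R + J%:R ^+ 2 * y.
  under eq_bigr => j _.
    rewrite big_split/= sumr_const card_ord (bigD1 j)//= eqxx big1 ?addr0; last first.
      by move=> k /negbTE; rewrite eq_sym -val_eqE/= => ->.
    over.
  by rewrite sumr_const card_ord /= -(mulr_natr y) -[LHS]mulr_natr; ring.
by rewrite le_eqVlt; apply/orP; left; apply/eqP; field; rewrite gt_eqF.
Qed.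

End SmallBall.

(** * Finite partitions, rounding, and small-ball bounds for i.i.d. samples *)

Lemma probability_finite_partition {R : realType} {dS : measure_display}
    {S : measurableType dS} (P : probability S R) (I : finType) (g : S -> I)
    (E : pred I) : (forall i, measurable (g @^-1` [set i])) ->
  measurable [set y | E (g y)] /\
  P [set y | E (g y)] = (\sum_(i | E i) fine (P (g @^-1` [set i])))%:E.
Proof.
move=> mg.
have setE : [set` enum E] = [set i | E i].
  by apply/seteqP; split => i /=; rewrite mem_enum.
have -> : [set y | E (g y)] = \bigcup_(i in [set i | E i]) (g @^-1` [set i]).
  apply/seteqP; split => [y Ey|y [i /= Ei yi]]; last by rewrite yi.
  by exists (g y).
have fin : finite_set [set i | E i] by exact: finite_finset.
have triv : trivIset [set i | E i] (fun i => g @^-1` [set i]).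
  by move=> i i' _ _ [y [/= <- <-]].
split; first exact: fin_bigcup_measurable.
rewrite measure_fin_bigcup// -setE -fsbig_seq ?enum_uniq// big_enum/= -sumEFin.
by apply: eq_bigr => i _; rewrite fineK ?fin_num_measure.
Qed.

Section Sample.
Context {R : realType} {dT dS : measure_display} {T : measurableType dT}
  {S : measurableType dS} {P : probability S R} {Q : probability T R}.

(** For a given [z], the event that the labels of the first n observations equal [z] is an
    intersection of preimages, so independence gives a product; [E] is a finite disjoint union of
    such events. *)
Lemma iid_finite_joint_law (xi : nat -> {RV Q >-> S}) (I : finType)
    (g : S -> I) (n : nat) (E : pred {ffun 'I_n -> I}) :
  iid_from P xi -> (forall i, measurable (g @^-1` [set i])) ->
  let A := [set w | E [ffun k : 'I_n => g (xi k w)]] in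
  measurable A /\
  Q A = (\sum_(z | E z) \prod_k fine (P (g @^-1` [set z k])))%:E.
Proof.
move=> [ind law] mg A.
pose cell (z : {ffun 'I_n -> I}) := [set w | [ffun k : 'I_n => g (xi k w)] = z].
(* Independence is stated for families of sets indexed by all naturals; beyond n the family is
   filled with the whole space. *)
pose B (z : {ffun 'I_n -> I}) (k : nat) : set S :=
  if insub k is Some k' then g @^-1` [set z k'] else setT.
have mB z k : measurable (B z k) by rewrite /B; case: insubP.
have cellE z : cell z = \big[setI/setT]_(k <- iota 0 n) (xi k @^-1` B z k).
  rewrite -bigcap_seq; apply/seteqP; split => w /=.
    move=> wz k /=; rewrite mem_iota add0n => /= kn.
    by rewrite /B insubT/= -wz ffunE.
  move=> wz; apply/ffunP => k; rewrite ffunE.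
  have /= := wz k; rewrite mem_iota add0n ltn_ord => /(_ isT).
  by rewrite /B valK.
have mcell z : measurable (cell z).
  rewrite cellE; apply: bigsetI_measurable => k _.
  by rewrite -[X in measurable X]setTI; exact: measurable_funPT.
have Qcell z : Q (cell z) = (\prod_k fine (P (g @^-1` [set z k])))%:E.
  rewrite cellE ind ?iota_uniq//.
  rewrite -{1}[n]subn0 -/(index_iota 0 n) big_mkord.
  rewrite (big_morph EFin (@EFinM _) (erefl _)).
  apply: eq_bigr => k _; rewrite -[LHS]/(distribution Q (xi k) (B z k)) law//.
  by rewrite /B valK fineK ?fin_num_measure.
have [mA QA] := probability_finite_partition Q E mcell.
split; first exact: mA.
by rewrite [LHS]QA; congr EFin; apply: eq_bigr => z _; rewrite Qcell.
Qed.

(** Values are rounded down to the grid -M, -M + eta, ... The fibres of [g] are preimages under [f]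
    of half-open intervals, hence measurable. *)
Lemma quantize (f : S -> R) (M eta : R) :
  measurable_fun setT f -> (forall y, `|f y| <= M) -> 0 < eta ->
  exists (N : nat) (g : S -> 'I_N.+1) (v : 'I_N.+1 -> R),
    [/\ forall i, measurable (g @^-1` [set i]), forall i, `|v i| <= M &
        forall y, `|f y - v (g y)| <= eta].
Proof.
move=> mf fM eta0.
pose N := Num.truncn (2 * M / eta).
pose t y := (f y + M) / eta.
have t0 y : 0 <= t y.
  by have := fM y; rewrite ler_norml => /andP[? _]; rewrite divr_ge0 ?(ltW eta0)//; lra.
have tN y : (Num.truncn (t y) < N.+1)%N.
  rewrite ltnS le_truncn// ler_pM2r ?invr_gt0//.
  by have := fM y; rewrite ler_norml => /andP[_ ?]; lra.
have M0 : 0 <= M by apply: le_trans (fM point).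
exists N, (fun y => inord (Num.truncn (t y))), (fun i => i%:R * eta - M); split.
- move=> i.
  have -> : (fun y => inord (Num.truncn (t y)) : 'I_N.+1) @^-1` [set i] =
      f @^-1` `[i%:R * eta - M, i.+1%:R * eta - M[%classic.
    apply/seteqP; split => y /=; rewrite in_itv/=.
      move=> <-; rewrite inordK//.
      have /andP[] := truncn_itv (t0 y).
      by rewrite ler_pdivlMr// ltr_pdivrMr// => ? ?; apply/andP; split; lra.
    move=> /andP[ly yu]; apply/val_inj; rewrite /= inordK//.
    apply/truncn_def; rewrite ler_pdivlMr// ltr_pdivrMr//.
    by apply/andP; split; lra.
  by rewrite -[X in measurable X]setTI; apply: mf => //; exact: measurable_itv.
- move=> i; have iN : i%:R * eta <= 2 * M.
    rewrite -ler_pdivlMr//; apply: (@le_trans _ _ N%:R); first by rewrite ler_nat -ltnS.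
    by rewrite truncn_le divr_ge0 ?(ltW eta0)// mulr_ge0.
  have i0 : 0 <= i%:R * eta by rewrite mulr_ge0// ltW.
  by rewrite ler_norml; lra.
- move=> y; rewrite inordK//.
  have /andP[] := truncn_itv (t0 y).
  rewrite ler_pdivlMr// ltr_pdivrMr// -natr1 => ? ?.
  by rewrite ler_norml; lra.
Qed.

(** Transfers [small_ball] from the rounded variables to [f]. The rounding error of the whole sum is
    at most W/2, which is why a window W for the rounded sum leaves W/2 here. *)
Lemma iid_small_ball (xi : nat -> {RV Q >-> S}) (f : S -> R) (H L : set S)
    (M kap W y a p r : R) (J n : nat) :
  iid_from P xi -> measurable_fun setT f -> (forall x, `|f x| <= M) ->
  measurable H -> measurable L -> 0 < kap ->
  (forall x, H x -> kap <= f x) -> (forall x, L x -> f x <= kap / 2) ->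
  0 <= p -> (p%:E <= P H)%E -> 0 <= r -> (r%:E <= P L)%E ->
  0 < W -> 2 * M <= W -> (0 < J)%N -> 0 <= y ->
  (1 - p * r * (kap / 4 / (J%:R * W)) ^+ 2 / 4) ^+ n <= y ^+ 2 ->
  exists A, [/\ measurable A,
    A `<=` [set w | W / 2 < `|\sum_(k < n) f (xi k w) - a|] &
    ((1 - (4 / J%:R + 4 * y))%:E <= Q A)%E].
Proof.
move=> iid mf fM mH mL kap0 Hf Lf p0 pH r0 rL W0 MW J0 y0 ny.
(* The first bound preserves a gap between high and low values, the second keeps n [eta] below W/2;
   [n.+1] keeps the mesh positive when n = 0. *)
pose eta := Num.min (kap / 8) (W / (2 * n.+1%:R)).
have eta0 : 0 < eta by rewrite lt_min !divr_gt0// mulr_gt0.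
have eta_kap : eta <= kap / 8 by rewrite /eta ge_min lexx.
have eta_n : n%:R * eta <= W / 2.
  have : n%:R * eta <= n.+1%:R * (W / (2 * n.+1%:R)).
    apply: ler_pM; [by []|exact: ltW|by rewrite ler_nat|].
    by rewrite /eta ge_min lexx orbT.
  have : n.+1%:R != 0 :> R by rewrite pnatr_eq0.
  by move: (n.+1%:R : R) => m m0; congr (_ <= _); field.
have [N [g [v [mg vM fv]]]] := quantize mf fM eta0.
pose q i := fine (P (g @^-1` [set i])).
have q0 i : 0 <= q i by rewrite fine_ge0.
have q1 : \sum_i q i = 1.
  have [_] := probability_finite_partition P predT mg.
  by rewrite [X in P X](_ : _ = setT) ?probability_setT; [case|exact/seteqP].
(* Rounding moves the thresholds kap and kap/2 by at most kap/8 each, leaving a gap of kap/4. *)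
pose hi : pred 'I_N.+1 := fun i => kap * (7 / 8) <= v i.
pose lo : pred 'I_N.+1 := fun i => v i <= kap * (5 / 8).
have ge_sum (E : pred 'I_N.+1) (B : set S) c : measurable B ->
    (forall x, B x -> E (g x)) -> (c%:E <= P B)%E -> c <= \sum_(i | E i) q i.
  move=> mB BE cB; rewrite -lee_fin; have [mE <-] := probability_finite_partition P E mg.
  by apply: le_trans cB _; rewrite le_measure ?inE.
have p_hi : p <= \sum_(i | hi i) q i.
  apply: ge_sum pH => // x /Hf fx; rewrite /hi.
  by have := fv x; rewrite ler_norml => /andP[_ ?]; lra.
have r_lo : r <= \sum_(i | lo i) q i.
  apply: ge_sum rL => // x /Lf fx; rewrite /lo.
  by have := fv x; rewrite ler_norml => /andP[? _]; lra.
have gap i j : hi i -> lo j -> kap / 4 <= v i - v j <= 2 * M.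
  rewrite /hi /lo => hi_i lo_j; have := vM i; have := vM j.
  by rewrite !ler_norml; lra.
have kap4 : 0 <= kap / 4 by rewrite divr_ge0// ltW.
have sb := @small_ball R _ q v q0 q1 hi lo (kap / 4) (2 * M) W y a p r J n
  kap4 W0 MW J0 y0 p0 p_hi r0 r_lo gap ny.
have [mA QA] := iid_finite_joint_law
  (fun z : {ffun 'I_n -> 'I_N.+1} => `|\sum_k v (z k) - a| <= W) iid mg.
exists (~` [set w | `|\sum_k v ([ffun k : 'I_n => g (xi k w)] k) - a| <= W]).
split.
- exact: measurableC.
- move=> w /= /negP; rewrite -ltNge => Wv.
  have dist : `|\sum_(k < n) f (xi k w) - \sum_k v ([ffun k : 'I_n => g (xi k w)] k)|
     <= n%:R * eta.
    rewrite -sumrB (le_trans (ler_norm_sum _ _ _))//.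
    rewrite mulr_natl -[X in _ *+ X]card_ord -sumr_const.
    by apply: ler_sum => k _; rewrite ffunE.
  have := ler_distD (\sum_(k < n) f (xi k w))
    (\sum_k v ([ffun k : 'I_n => g (xi k w)] k)) a.
  by rewrite distrC in dist; lra.
- rewrite probability_setC// QA -EFinB lee_fin lerD2l lerN2; exact: sb.
Qed.

End Sample.

(** * Euclidean norm: scaling, continuity and Borel measurability *)

Section Euclidean.
Context {R : realType} {d : nat}.
Implicit Types x y : Rvec R d.

Lemma enormZ (c : R) x : enorm (c *: x) = `|c| * enorm x.
Proof.
rewrite /enorm -sqrtr_sqr -sqrtrM ?sqr_ge0// mulr_sumr.
by congr Num.sqrt; apply: eq_bigr => i _; rewrite mxE exprMn.
Qed.

Lemma enorm_distC x y : enorm (x - y) = enorm (y - x).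
Proof.
by rewrite /enorm; congr Num.sqrt; apply: eq_bigr => i _; rewrite !mxE -sqrrN opprB.
Qed.

Lemma continuous_enormB x : continuous (fun y : 'rV[R]_d => enorm (y - x)).
Proof.
move=> y; apply: (@continuous_comp _ _ _ (fun y : 'rV[R]_d =>
  \sum_(i < d) (y - x) ord0 i ^+ 2) Num.sqrt); last exact: sqrt_continuous.
apply: (continuous_big (op := +%R)) => [|i _].
  exact: add_continuous.
have coord : continuous (fun z : 'rV[R]_d => z ord0 i - (x : 'rV[R]_d) ord0 i).
  by move=> z; apply: continuousB; [exact: coord_continuous|exact: cst_continuous].
rewrite [X in continuous X](_ : _ =
    (fun t : R => t ^+ 2) \o (fun z : 'rV[R]_d => z ord0 i - (x : 'rV[R]_d) ord0 i)).
  by move=> z; apply: continuous_comp; [exact: coord|exact: exprn_continuous].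
by apply/funext => z; rewrite /= !mxE.
Qed.

Lemma measurable_eball x r : measurable (eball x r).
Proof.
apply: sub_sigma_algebra.
rewrite [X in open X](_ : _ =
  (fun y : 'rV[R]_d => enorm (y - x)) @^-1` [set t | t < r])//.
apply: open_comp; last exact: open_lt.
by move=> y _; exact: continuous_enormB.
Qed.

Lemma measurable_fun_rescale x (h : R) :
  measurable_fun setT (fun y : Rvec R d => h *: (x - y) : Rvec R d).
Proof.
apply: (@measurability _ _ (Rvec R d) (Rvec R d) setT _ (@open 'rV[R]_d)) => //.
move=> _ [B oB <-]; rewrite setTI.
apply: sub_sigma_algebra.
apply: (@open_comp 'rV[R]_d 'rV[R]_d (fun y => h *: (x - y))) => // y _.
apply: continuous_comp; last exact: scaler_continuous.
by apply: continuousB; [exact: cst_continuous|exact: cvg_id].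
Qed.

End Euclidean.

(** * Extracting a small kernel tail from the integral condition *)

Section Integral.
Import HBNNSimple.

(** The integral of a nonnegative function is the supremum of the integrals of the simple functions
    below it, and c times the indicator of [A] is one of them. This suits tail suprema over
    uncountable sets. *)
Lemma integral_ge_cst_subset {d : measure_display} {T : measurableType d}
    {R : realType} (mu : {measure set T -> \bar R}) (D A : set T)
    (f : T -> \bar R) (c : R) :
  measurable A -> A `<=` D -> 0 <= c -> (forall x, D x -> (0 <= f x)%E) ->
  (forall x, A x -> (c%:E <= f x)%E) ->
  (c%:E * mu A <= \int[mu]_(x in D) f x)%E.
Proof.
move=> mA AD c0 f0 cf; rewrite ge0_integralE//; apply: ereal_sup_ubound => /=.
exists (scale_nnsfun (indic_nnsfun R mA) c0) => /=.
  move=> x; rewrite patchE measurable_realfun.mindicE; have [xA|xA] := boolP (x \in A).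
    have Ax : A x by rewrite inE in xA.
    by rewrite mulr1 mem_set; [exact: cf|exact: AD].
  by rewrite mulr0; case: ifPn => // /[!inE]; exact: f0.
have <- : sintegral mu (indic_nnsfun R mA) = mu A by exact: sintegral_indic.
by rewrite -sintegralrM.
Qed.

Lemma near_at_right0 {R : realType} (A : set R) :
  (\forall r \near 0^'+, A r) -> exists2 e : R, 0 < e & forall r, 0 < r < e -> A r.
Proof.
rewrite near_withinE => /nbhs_ballP[e /= e0 eA].
exists e => // r /andP[r0 re]; apply: eA => //.
by rewrite /ball/= sub0r normrN gtr0_norm.
Qed.

(* A tail supremum bounded below by [c] would force the integral to be at
   least [c / 2 * N ^ a] for all [N], the contribution of [N, 2N]. *)
Lemma radial_integral_tail {R : realType} (a c : R) (G : R -> \bar R) :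
  0 < a -> 0 < c ->
  (\int[lebesgue_measure]_(t in `]0%R, +oo[)
     ((t `^ (a - 1))%:E * G t) < +oo)%E ->
  exists2 t, 0 < t & (G t < c%:E)%E.
Proof.
move=> a0 c0 fin; apply: contrapT => H.
have cG t : 0 < t -> (c%:E <= G t)%E.
  by move=> t0; rewrite leNgt; apply/negP => Gc; apply: H; exists t.
have lb (N : R) : 0 < N -> ((N `^ a * (c / 2))%:E <=
    \int[lebesgue_measure]_(t in `]0%R, +oo[) ((t `^ (a - 1))%:E * G t))%E.
  move=> N0.
  have mN : measurable (`[N, (2 * N)%R]%classic : set R) by exact: measurable_itv.
  have muN : lebesgue_measure (`[N, (2 * N)%R]%classic : set R) = N%:E.
    by rewrite lebesgue_measure_itv/= lte_fin ifT -?EFinB; [congr EFin|]; lra.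
  have -> : ((N `^ a * (c / 2))%:E = ((N `^ a / (2 * N)) * c)%:E *
      lebesgue_measure (`[N, (2 * N)%R]%classic : set R))%E.
    by rewrite muN -EFinM; congr EFin; field; rewrite gt_eqF.
  apply: integral_ge_cst_subset => //.
  - move=> t /=; rewrite !in_itv/= andbT => /andP[Nt _]; exact: lt_le_trans Nt.
  - by rewrite mulr_ge0 ?divr_ge0 ?powR_ge0 ?ltW// mulr_gt0.
  - move=> t /=; rewrite in_itv/= andbT => t0.
    rewrite mule_ge0 ?lee_fin ?powR_ge0//; apply: le_trans (cG _ t0).
    by rewrite lee_fin ltW.
  - move=> t /=; rewrite in_itv/= => /andP[Nt tN].
    have t0 : 0 < t by exact: lt_le_trans Nt.
    apply: (@le_trans _ _ ((t `^ (a - 1))%:E * c%:E)%E); last first.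
      by rewrite lee_wpmul2l ?cG// lee_fin powR_ge0.
    rewrite -EFinM lee_fin; apply: ler_wpM2r; first exact: ltW.
    (* Splitting t^(a-1) as t^a / t gives the lower bound N^a/(2N) whatever the sign of a - 1. *)
    rewrite powRD ?(gt_eqF t0) ?implybT// powR_inv1 ?(ltW t0)//.
    apply: ler_pM; [exact: powR_ge0|by rewrite invr_ge0 mulr_ge0 ?ltW| |].
      by apply: ge0_ler_powR; rewrite ?nnegrE ?(ltW a0) ?(ltW N0) ?(ltW t0).
    by rewrite lef_pV2 ?posrE// mulr_gt0.
have [m intm] : exists m : R, (\int[lebesgue_measure]_(t in `]0%R, +oo[)
    ((t `^ (a - 1))%:E * G t) <= m%:E)%E.
  move: fin; case: (\int[lebesgue_measure]_(t in _) _)%E => [m _|//|_].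
    by exists m.
  by exists 0; rewrite leNye.
(* Solves N^a c/2 = |m| + 1, which exceeds the bound m on the integral. *)
pose N := ((`|m| + 1) * (2 / c)) `^ a^-1.
have N0 : 0 < N by rewrite powR_gt0// mulr_gt0 ?divr_gt0// ltr_wpDl.
have := le_trans (lb N N0) intm.
rewrite /N -powRrM mulVf ?gt_eqF// powRr1; last first.
  by rewrite mulr_ge0 ?addr_ge0// divr_ge0// ltW.
rewrite lee_fin.
have -> : (`|m| + 1) * (2 / c) * (c / 2) = `|m| + 1 by field; rewrite gt_eqF.
by have := ler_norm m; lra.
Qed.

End Integral.

(** * Quantitative forms of the assumptions on P and K *)

Section Hypotheses.
Context {R : realType} {d : nat}.
Implicit Types (X : set (Rvec R d)) (P : probability (Rvec R d) R)
  (K : Rvec R d -> R).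

Lemma lty_le_pos (y : \bar R) : (y < +oo)%E -> exists2 M : R, 0 < M & (y <= M%:E)%E.
Proof.
case: y => [m _|//|_]; last by exists 1; rewrite ?leNye.
by exists (`|m| + 1); [rewrite ltr_wpDl|rewrite lee_fin; have := ler_norm m; lra].
Qed.

Lemma gt0_ge_pos (y : \bar R) : (0 < y)%E -> exists2 c : R, 0 < c & (c%:E <= y)%E.
Proof.
case: y => [m|_|//]; first by rewrite lte_fin => m0; exists m.
by exists 1; rewrite ?leey.
Qed.

(** A positive supremum yields one point with positive lower limit; that limit is a supremum of
    infima over neighbourhoods, so one of these infima is positive and supplies c. *)
Lemma liminf_ball_lower_bound X P (a : R) :
  (0 < ereal_sup [set limf_einf (fun r : R =>
         P (eball x r) / (r `^ a)%:E) 0^'+ | x in X])%E ->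
  exists2 x, X x & exists2 c : R, 0 < c &
    \forall r \near 0^'+, ((c * r `^ a)%:E <= P (eball x r))%E.
Proof.
move=> /ereal_sup_gt[_ [x Xx <-]].
rewrite limf_einfE => /ereal_sup_gt[_ [V FV <-]] /gt0_ge_pos[c c0 cV].
exists x => //; exists c => //.
near=> r.
have r0 : 0 < r by near: r; exact: nbhs_right_gt.
have Vr : V r by near: r.
have := le_trans cV (ereal_inf_lbound (imageP _ Vr)).
by rewrite inver gt_eqF ?powR_gt0// lee_pdivlMr ?powR_gt0.
Unshelve. all: by end_near. Qed.

(** Positive volume dimension provides some nu > 0 with P(B(x, r)) <= M r^nu for small r, and r^nu
    tends to 0. *)
Lemma vol_dim_gt0_ball_small X P x (e : R) :
  (0 < vol_dim X P)%E -> X x -> 0 < e ->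
  \forall r \near 0^'+, (P (eball x r) <= e%:E)%E.
Proof.
move=> /ereal_sup_gt[_ [nu [_ infV] <-]].
move: infV => /ereal_inf_lt[_ [V FV <-] /lty_le_pos[M M0 VM]].
rewrite lte_fin => nu0 Xx e0.
near=> r.
have r0 : 0 < r by near: r; exact: nbhs_right_gt.
have Vr : V r by near: r.
apply: (@le_trans _ _ (M * r `^ nu)%:E).
  have := le_trans (ereal_sup_ubound (imageP _ Vr)) VM.
  move=> /(le_trans (ereal_sup_ubound (imageP _ Xx))).
  by rewrite inver gt_eqF ?powR_gt0// lee_pdivrMr ?powR_gt0.
rewrite lee_fin mulrC -ler_pdivlMr//.
near: r.
apply: (cvgr_le 0 (powR_cvg0 nu0)); exact: divr_gt0.
Unshelve. all: by end_near. Qed.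

(** The infimum is nonincreasing in t, so the limit at 0 exists and would be at most 0 if every
    infimum were. *)
Lemma lim_inf_ball_gt0 K :
  (0 < lim (ereal_inf [set (K x)%:E | x in [set x | (enorm x <= t)%R]]
              @[t --> 0^'+]))%E ->
  exists2 kap, 0 < kap & exists2 t, 0 < t & forall x, enorm x <= t -> kap <= K x.
Proof.
set f := fun t : R => ereal_inf _ => lim0.
have [t t0 /gt0_ge_pos[kap kap0 kapf]] : exists2 t, 0 < t & (0 < f t)%E.
  apply: contrapT => H.
  have f0 t : 0 < t -> (f t <= 0)%E.
    by move=> t0; rewrite leNgt; apply/negP => ft; apply: H; exists t.
  suff : (lim (f t @[t --> 0^'+]) <= 0)%E by rewrite leNgt lim0.
  apply: lime_le.
    apply: nonincreasing_at_right_is_cvge; near=> x => s t _ _ st.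
    apply: le_ereal_inf => _ [u us <-]; exists u => //=; exact: le_trans st.
  by near=> t; apply: f0; near: t; exact: nbhs_right_gt.
exists kap => //; exists t => // x xt.
by rewrite -lee_fin; apply: le_trans kapf _; apply: ereal_inf_lbound; exists x.
Unshelve. all: by end_near. Qed.

End Hypotheses.

(** * Final estimates and choice of constants *)

(** The induction rests on (1 - z)(1 + (n+1)z) = 1 + nz - (n+1)z^2. With z = J^2/n it bounds (1 -
    z)^n by 1/(1 + J^2). *)
Lemma expr_1B_bernoulli {R : realType} (z : R) n : 0 <= z <= 1 ->
  (1 - z) ^+ n * (1 + n%:R * z) <= 1.
Proof.
move=> /andP[z0 z1].
elim: n => [|n IH]; first by rewrite expr0 mul0r addr0 mulr1.
apply: le_trans IH; rewrite exprSr -mulrA ler_wpM2l ?exprn_ge0 ?subr_ge0//.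
rewrite -natr1; have := mulr_ge0 (ler0n R n) (sqr_ge0 z); have := sqr_ge0 z; lra.
Qed.

(** Separates the normalisation of the estimator from sqrt(n h^a), the fluctuation scale of the
    unnormalised sum. *)
Lemma sqrt_rate {R : realType} (d n : nat) (h a : R) : 0 < h -> (0 < n)%N ->
  Num.sqrt (1 / (n%:R * h `^ (2 * d%:R - a))) =
  (n%:R * h ^+ d)^-1 * Num.sqrt (n%:R * h `^ a).
Proof.
move=> h0 n0; have n0' : 0 < n%:R :> R by rewrite ltr0n.
have nh : 0 < n%:R * h ^+ d by rewrite mulr_gt0// exprn_gt0.
have nhV : 0 < (n%:R * h ^+ d)^-1 by rewrite invr_gt0.
rewrite -[in RHS](gtr0_norm nhV) -sqrtr_sqr -sqrtrM ?sqr_ge0//.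
congr Num.sqrt; rewrite powRD ?(gt_eqF h0) ?implybT// powRN.
have -> : h `^ (2 * d%:R) = (h ^+ d) ^+ 2.
  by rewrite -natrM powR_mulrn ?ltW// mulnC exprM.
by field; rewrite !gt_eqF ?powR_gt0 ?exprn_gt0.
Qed.

Theorem corollary17 (R : realType) (d : nat) (X : set (Rvec R d))
    (P : probability (Rvec R d) R) (dvol : R) (K : Rvec R d -> R) (delta : R) :
  0 < delta < 1 ->
  vol_dim X P = dvol%:E ->
  0 < dvol ->
  (0 < ereal_sup [set limf_einf (fun r : R =>
         P (eball x r) / (r `^ dvol)%:E) 0^'+ | x in X])%E ->
  measurable_fun setT K ->
  (ereal_sup [set `|K x|%:E | x in setT] < +oo)%E ->
  (\int[lebesgue_measure]_(t in `]0%R, +oo[)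
     ((t `^ (dvol - 1))%:E *
      ereal_sup [set `|K x|%:E | x in [set x | (t <= enorm x)%R]]) < +oo)%E ->
  (0 < lim (ereal_inf [set (K x)%:E | x in [set x | (enorm x <= t)%R]]
              @[t --> 0^'+]))%E ->
  exists2 C : R, 0 < C &
    forall l : nat -> R,
      (forall n, 0 < l n) ->
      l n @[n --> \oo] --> (0 : R) ->
      n%:R * l n `^ dvol @[n --> \oo] --> +oo ->
      forall (dT : measure_display) (T : measurableType dT)
        (Q : probability T R) (xi : nat -> {RV Q >-> Rvec R d}),
        iid_from P xi ->
        \forall n \near \oo,
          with_prob_ge Q (1 - delta)
            [set w |
              ((C * Num.sqrt (1 / (n%:R * l n `^ (2 * d%:R - dvol))))%:E <=
               ereal_sup [set `|kde K xi n hx.1 hx.2 w -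
                                mean_kde K Q xi n hx.1 hx.2|%:E
                         | hx in [set hx : R * Rvec R d |
                                   (l n <= hx.1)%R /\ X hx.2]])%E].
Proof.
move=> /andP[delta0 delta1] volP dvol0 /liminf_ball_lower_bound[x Xx [c c0 ballP]].
move=> mK /lty_le_pos[M M0 KM] tailK /lim_inf_ball_gt0[kap kap0 [t0 t00 Kt0]].
have {}KM u : `|K u| <= M.
  by rewrite -lee_fin; apply: le_trans KM; apply: ereal_sup_ubound; exists u.
have [T0 T00 KT] := radial_integral_tail dvol0 (divr_gt0 kap0 (ltr0n R 2)) tailK.
have {}KT u : T0 <= enorm u -> K u <= kap / 2.
  move=> uT; rewrite (le_trans (ler_norm _))// -lee_fin; apply: le_trans (ltW KT).
  by apply: ereal_sup_ubound; exists u.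
have [e1 e10 low] := near_at_right0 ballP.
have [e2 e20 up] : exists2 e : R, 0 < e &
    forall r, 0 < r < e -> (P (eball x r) <= (2^-1 : R)%:E)%E.
  apply: near_at_right0; apply: (@vol_dim_gt0_ball_small _ _ X) => //.
  by rewrite volP lte_fin.
(* J > 8/delta, so the failure bound 4/J + 4y with y = 1/J is at most delta. *)
pose J := (Num.truncn (8 / delta)).+1.
have J0 : 0 < J%:R :> R by rewrite ltr0n.
have Jdelta : 4 / J%:R + 4 * J%:R^-1 <= delta.
  rewrite -mulrDl ler_pdivrMr// mulrC -ler_pdivrMr//.
  by rewrite (le_trans _ (ltW (truncnS_gt _))) ?ler_pM2r ?invr_gt0//; lra.
(* Solved from the requirement, verified in [zE], that the characteristic-function deficit be
   exactly J^2/n when W^2 = A n h^dvol. *)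
pose A := c * t0 `^ dvol * kap ^+ 2 / (128 * J%:R ^+ 4).
have A0 : 0 < A by rewrite divr_gt0 ?mulr_gt0 ?powR_gt0 ?exprn_gt0.
pose ep := Num.sqrt A.
have ep0 : 0 < ep by rewrite sqrtr_gt0.
have epE : ep ^+ 2 = A by rewrite sqr_sqrtr ?ltW.
(* The factor 1/2 is the loss W to W/2 in [iid_small_ball]. Everything in this constant is fixed
   before [l], [Q] and [xi] are introduced. *)
exists (ep / 2); first by rewrite divr_gt0.
move=> l l0 lcvg nlcvg dT T Q xi iid.
near=> n.
set h := l n; have h0 : 0 < h by exact: l0.
(* Makes J^2/n at most 1, as the Bernoulli bound requires. *)
have nJ : (J ^ 2 < n)%N by near: n; exact: nbhs_infty_gt.
have n0 : (0 < n)%N by exact: leq_ltn_trans nJ.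
have n0' : 0 < n%:R :> R by rewrite ltr0n.
have ht0 : l n < e1 / t0.
  near: n; apply: (cvgr_lt 0 lcvg); exact: divr_gt0.
have hT0 : l n < e2 / T0.
  near: n; apply: (cvgr_lt 0 lcvg); exact: divr_gt0.
(* Equivalent to 2M <= W: the spread of the summands must fit in the window. This is where n
   l_n^dvol -> oo enters. *)
have nh : (2 * M / ep) ^+ 2 <= n%:R * l n `^ dvol.
  by near: n; move/cvgryPge : nlcvg; exact.
rewrite -/h in ht0 hT0 nh; set m := n%:R * h `^ dvol in nh.
have m0 : 0 < m by rewrite mulr_gt0// powR_gt0.
pose W := ep * Num.sqrt m.
have W0 : 0 < W by rewrite mulr_gt0// sqrtr_gt0.
have MW : 2 * M <= W.
  have : 0 <= 2 * M / ep by rewrite divr_ge0 ?mulr_ge0 ?(ltW M0) ?(ltW ep0).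
  move=> Mep0; rewrite /W [leRHS]mulrC -ler_pdivrMr// -ler_sqr ?nnegrE ?sqrtr_ge0//.
  by rewrite sqr_sqrtr ?(ltW m0).
pose f y := K (h^-1 *: (x - y)).
have enormh y : enorm (h^-1 *: (x - y)) = enorm (y - x) / h.
  by rewrite enormZ gtr0_norm ?invr_gt0// enorm_distC mulrC.
have mf : measurable_fun setT f.
  by apply: measurableT_comp mK _; exact: measurable_fun_rescale.
have Hf y : eball x (h * t0) y -> kap <= f y.
  by move=> xy; apply: Kt0; rewrite enormh ler_pdivrMr// mulrC ltW.
have Lf y : (~` eball x (h * T0)) y -> f y <= kap / 2.
  move=> /negP; rewrite -leNgt => xy.
  by apply: KT; rewrite enormh ler_pdivlMr// mulrC.
pose p := c * (h * t0) `^ dvol.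
have p0 : 0 <= p by rewrite mulr_ge0 ?powR_ge0// ltW.
have PH : (p%:E <= P (eball x (h * t0)))%E.
  by apply: low; rewrite mulr_gt0//= -ltr_pdivlMr.
have PL : ((2^-1 : R)%:E <= P (~` eball x (h * T0)))%E.
  rewrite probability_setC; last exact: measurable_eball.
  have : (P (eball x (h * T0)) <= (2^-1 : R)%:E)%E.
    by apply: up; rewrite mulr_gt0//= -ltr_pdivlMr.
  have := @fin_num_measure _ _ _ P _ (measurable_eball x (h * T0)).
  by case: (P _) => // r _; rewrite -EFinB !lee_fin; lra.
have zE : p * 2^-1 * (kap / 4 / (J%:R * W)) ^+ 2 / 4 = J%:R ^+ 2 / n%:R.
  have m_neq0 : m != 0 by rewrite gt_eqF.
  rewrite /p /W powRM ?(ltW h0) ?(ltW t00)//.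
  have -> : (kap / 4 / (J%:R * (ep * Num.sqrt m))) ^+ 2 =
     kap ^+ 2 / 16 / (J%:R ^+ 2 * (A * m)).
    rewrite -epE -[in RHS](sqr_sqrtr (ltW m0)).
    by field; rewrite !gt_eqF ?sqrtr_gt0.
  rewrite /A /m; field.
  by rewrite !gt_eqF ?powR_gt0.
have small : (1 - p * 2^-1 * (kap / 4 / (J%:R * W)) ^+ 2 / 4) ^+ n <= J%:R^-1 ^+ 2.
  rewrite zE.
  have z01 : 0 <= J%:R ^+ 2 / (n%:R : R) <= 1.
    by rewrite divr_ge0 ?exprn_ge0//= ler_pdivrMr// mul1r -natrX ler_nat ltnW.
  have := expr_1B_bernoulli n z01.
  rewrite [_ * (_ / _)]mulrC divfK ?gt_eqF// => bern.
  rewrite exprVn -[leRHS]div1r ler_pdivlMr ?exprn_gt0//; apply: le_trans bern.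
  by rewrite ler_wpM2l ?exprn_ge0 ?subr_ge0 ?lerDr//; case/andP: z01.
(* Dividing the sum minus [a] by n h^d gives the estimator minus its mean. *)
pose a := n%:R * h ^+ d * mean_kde K Q xi n h x.
have [E [mE EW QE]] := @iid_small_ball R _ _ T (Rvec R d) P Q xi f
  (eball x (h * t0)) (~` eball x (h * T0)) M kap W J%:R^-1 a p 2^-1 J n
  iid mf (fun y => KM _) (measurable_eball _ _) (measurableC (measurable_eball _ _))
  kap0 Hf Lf p0 PH (ltac:(by rewrite invr_ge0)) PL W0 MW isT
  (ltac:(by rewrite invr_ge0)) small.
exists E; split => //; last by apply: le_trans QE; rewrite lee_fin lerD2l lerN2.
move=> w /EW /= WE.
apply: (@le_trans _ _ (`|kde K xi n h x w - mean_kde K Q xi n h x|)%:E); last first.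
  by apply: ereal_sup_ubound; exists (h, x).
have nhd : 0 < n%:R * h ^+ d by rewrite mulr_gt0// exprn_gt0.
rewrite lee_fin sqrt_rate// mulrCA -/m.
have -> : kde K xi n h x w - mean_kde K Q xi n h x =
   (n%:R * h ^+ d)^-1 * (\sum_(k < n) f (xi k w) - a).
  by rewrite mulrBr /a mulKf ?gt_eqF.
rewrite normrM gtr0_norm ?invr_gt0// ler_pM2l ?invr_gt0//.
by apply: le_trans (ltW WE); rewrite /W mulrAC.
Unshelve. all: by end_near. Qed.
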